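(* Let $k \ge 3$, $2 \le \ell < k$ and $0<p<1$. Then the properties $\mathrm{CliqueDisc}_p[\ell,1]$, $\mathrm{CliqueDisc}_p[\ell,2]$, $\dots$, $\mathrm{CliqueDisc}_p[\ell,\binom{k}{\ell}]$ of sequences of $k$-uniform hypergraphs are all equivalent: for all $1 \le s,s' \le \binom{k}{\ell}$, a sequence $\{H_n\}_{n\to\infty}$ of $k$-uniform hypergraphs with $|V(H_n)|=n$ satisfies $\mathrm{CliqueDisc}_p[\ell,s]$ if and only if it satisfies $\mathrm{CliqueDisc}_p[\ell,s']$.
   Context: A $k$-uniform hypergraph $G$ is a pair of finite sets $(V(G),E(G))$ where $E(G)$ is a collection of $k$-subsets of $V(G)$. For $U\subseteq V(G)$, $G[U]$ is the hypergraph with vertex set $U$ and edge set $\{e\in E(G): e\subseteq U\}$. Let $\{H_n\}_{n\to\infty}$ be a sequence of $k$-uniform hypergraphs with $|V(H_n)|=n$, let $0<p<1$ be a fixed real, $1\le \ell\le k-1$ and $1\le s\le\binom{k}{\ell}$. The sequence satisfies $\mathrm{CliqueDisc}_p[\ell,s]$ if for every $\ell$-uniform hypergraph $G$ with $V(G)\subseteq V(H_n)$, $$\left|\{T\in E(H_n): T\subseteq V(G),\ |E(G[T])|\ge s\}\right| = p\left|\left\{T\in\binom{V(G)}{k}: |E(G[T])|\ge s\right\}\right| + o(n^k).$$ Here the $o(n^k)$ term is uniform: there is a function $f:\mathbb{N}\to\mathbb{R}$ with $f(n)/n^k\to 0$ such that for all $n$ and all such $G$, the two sides differ by at most $f(n)$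 in absolute value. *)

(* Defs.v *)
From HB Require Import structures.
From mathcomp Require Import all_boot all_order all_algebra.
From mathcomp Require Import all_classical all_reals all_analysis.

Set Implicit Arguments.
Unset Strict Implicit.
Unset Printing Implicit Defensive.

Import Order.TTheory GRing.Theory Num.Theory.
Import numFieldNormedType.Exports.

Local Open Scope ring_scope.

(* The vertices live in an ambient finite type [V]; the vertex set itself is
   the subset [vset] of [V], so that hypergraphs with different vertex sets can
   be compared. *)
Record hypergraph (V : finType) (k : nat) := Hypergraph {
  vset : {set V};
  eset : {set {set V}};
  esetP : forall e : {set V}, e \in eset -> e \subset vset /\ #|e| = k
}.

Lemma induced_subproof (V : finType) (k : nat) (G : hypergraph V k)
    (U : {set V}) (e : {set V}) :
  e \in [set e' in eset G | e' \subset U] -> e \subset U /\ #|e| = k.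
Proof. by rewrite inE => /andP[/esetP[_ ->] ->]. Qed.

Definition induced (V : finType) (k : nat) (G : hypergraph V k) (U : {set V}) :
    hypergraph V k :=
  Hypergraph (@induced_subproof V k G U).

(* The error term [f] is chosen before [n] and [G], so it is uniform in [G].
   The quotient [f n / n ^ k] at [n = 0] is irrelevant to the limit. *)
Definition CliqueDisc (R : realType) (p : R) (k l s : nat) (V : nat -> finType)
    (H : forall n : nat, hypergraph (V n) k) : Prop :=
  exists f : nat -> R,
    ((fun n : nat => f n / n%:R ^+ k) @ \oo --> (0 : R))%classic /\
    forall (n : nat) (G : hypergraph (V n) l), vset G \subset vset (H n) ->
      `| #|[set T in eset (H n) |
             (T \subset vset G) && (s <= #|eset (induced G T)|)%N]|%:R
         - p * #|[set T : {set V n} |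
             [&& T \subset vset G, #|T| == k
               & (s <= #|eset (induced G T)|)%N]]|%:R | <= f n.

(* Main.v *)
Require Import Defs.
From mathcomp Require Import all_boot all_order all_algebra.
From mathcomp Require Import all_classical all_reals all_analysis.

Set Implicit Arguments.
Unset Strict Implicit.
Unset Printing Implicit Defensive.

Import Order.TTheory GRing.Theory Num.Theory.
Import numFieldNormedType.Exports.
From mathcomp Require Import fintype finset.

Local Open Scope ring_scope.

(** Write [m] for ['C(k, l)], let [h T = 1 - p] if [T] is an edge of the
    [k]-uniform hypergraph [H] and [h T = - p] otherwise, and let [N_s(G)] be
    the sum of [h T] over the [k]-sets [T] of vertices of [G] spanning at least
    [s] edges of [G]. The property says that [N_s(G)] is [o(n^k)] uniformly in
    [G]. All these properties are equivalent for a reason that has nothing to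
    do with limits: for every weight [h] and all [1 <= s, s' <= m], a bound [B]
    on all the [|N_s(G)|] gives the bound [C * B] on all the [|N_s'(G)|], with
    [C] depending only on [k] and [l] ([disc_threshold_change]).

    Colour the vertices with [k] colours and call [T] rainbow if it has one
    vertex of each colour. The [l]-subsets of a rainbow [T] are then indexed by
    the [l]-sets of colours, so that edges of [G] may be kept, deleted or
    complemented according to their colour set, independently for each of the
    [m] colour sets. This gives four comparisons.

    - Inclusion-exclusion over the set of colours allowed in the vertex set of
      [G] restricts [N_s] to rainbow [T] ([ler_norm_rainbow_disc]).

    - Let [J] be the set of colour sets of the edges of [G] inside a rainbow
      [T]. Keeping only the edges whose colour set is in [Q] replaces [J] by
      [Q :&: J], and the signed sum over all [Q] of the indicators
      [s <= #|Q :&: J|] vanishes unless [J] is everything, since otherwise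
      toggling a missing colour set in [Q] is a sign-reversing involution. When
      [J] is everything the sum is [+- 'C(m - 1, s - 1)], which is nonzero
      exactly because [1 <= s <= m]. So threshold [s] controls threshold [m],
      that is, cliques ([ler_norm_rainbow_clique]).

    - Cliques control every threshold: [s' <= #|J|] holds iff [J] is one of the
      patterns [P] with at least [s'] elements, and [J = P] says that [T] is a
      clique once [G] is complemented among the [l]-sets with colour set
      outside [P] ([ler_norm_rainbow_threshold]).

    - Every [k]-set is rainbow for the same positive proportion [k! / k^k] of
      all colourings, so averaging over colourings removes the restriction to
      rainbow sets ([ler_norm_disc_average]). *)

(** * Signed sums over subsets *)

Lemma sum_subsetsD1 (R : nmodType) (I : finType) (K : {set I}) (x : I)
    (F : {set I} -> R) : x \in K ->
  \sum_(Q : {set I} | Q \subset K) F Q =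
  \sum_(Q : {set I} | Q \subset K :\ x) (F Q + F (x |: Q)).
Proof.
move=> xK; rewrite big_split /= (bigID (fun Q : {set I} => x \in Q)) /= addrC.
congr (_ + _); first by apply: eq_bigl => Q; rewrite subsetD1.
rewrite (reindex_onto (fun Q => x |: Q) (fun Q => Q :\ x)) /=.
  apply: eq_bigl => Q; rewrite setU11 subUset sub1set xK andbT /=.
  rewrite subsetD1; congr (_ && _).
  apply/eqP/idP => [<-|xQ]; first by rewrite !inE eqxx.
  by rewrite setU1K.
by move=> Q /andP[_ xQ]; rewrite setD1K.
Qed.

(** Toggling [x] is a sign-reversing involution on the subsets of [K]. *)
Lemma sum_signed_subsets_eq0 (R : pzRingType) (I : finType) (K : {set I})
    (x : I) (F : {set I} -> R) : x \in K -> (forall Q, F (x |: Q) = F Q) ->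
  \sum_(Q : {set I} | Q \subset K) (-1) ^+ #|Q| * F Q = 0.
Proof.
move=> xK FE; rewrite (sum_subsetsD1 _ xK) big1 // => Q.
rewrite subsetD1 => /andP[_ xQ].
by rewrite FE cardsU1 xQ exprS mulN1r mulNr subrr.
Qed.

(** Pairing [Q] with [x |: Q] for a fixed [x] in [K], the two terms cancel
    unless [#|Q| = s.-1], where the threshold is crossed; such [Q] are counted
    by the binomial coefficient. *)
Lemma sum_signed_threshold (R : pzRingType) (I : finType) (K : {set I})
    (s : nat) : (0 < s)%N -> (0 < #|K|)%N ->
  \sum_(Q : {set I} | Q \subset K) (-1) ^+ #|Q| * (s <= #|Q|)%N%:R =
  (-1) ^+ s * 'C(#|K|.-1, s.-1)%:R :> R.
Proof.
case: s => // s _ K0; have /card_gt0P[x xK] := K0.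
rewrite (sum_subsetsD1 _ xK).
have -> : #|K|.-1 = #|K :\ x| by rewrite (cardsD1 x K) xK.
rewrite /= -cards_draws -sumr_const mulr_sumr.
under [RHS]eq_bigl do rewrite inE.
rewrite [RHS]big_mkcondr /=; apply: eq_bigr => Q.
rewrite subsetD1 => /andP[_ xQ].
rewrite cardsU1 xQ /= add1n ltnS exprS mulN1r mulNr -mulrBr.
case: (ltngtP s #|Q|) => [||->]; rewrite ?subrr ?mulr0 //.
by rewrite sub0r mulrN1 exprS mulN1r mulr1.
Qed.

(** An element of [K] outside [J] can be toggled in [Q] without changing
    [Q :&: J]. *)
Lemma sum_signed_threshold_setI (R : pzRingType) (I : finType) (K J : {set I})
    (s : nat) : J \subset K ->
  \sum_(Q : {set I} | Q \subset K) (-1) ^+ #|Q| * (s <= #|Q :&: J|)%N%:R =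
  (\sum_(Q : {set I} | Q \subset K) (-1) ^+ #|Q| * (s <= #|Q|)%N%:R)
  * (#|K| <= #|J|)%N%:R :> R.
Proof.
move=> JK; case: leqP => [KJ|JltK].
  have -> : J = K by apply/eqP; rewrite eqEcard JK.
  by rewrite mulr1; apply: eq_bigr => Q /setIidPl ->.
have /properP[_ [x xK xJ]] : J \proper K by rewrite properEcard JK.
rewrite mulr0; apply: (sum_signed_subsets_eq0 xK) => Q.
congr (_ <= _)%N%:R; congr #|pred_of_set _|.
by apply/setP => y; rewrite !inE; case: eqP => // ->; rewrite (negPf xJ) !andbF.
Qed.

Lemma ler_norm_sum_const (R : numDomainType) (I : finType) (P : pred I)
    (F : I -> R) (B : R) (N : nat) :
  0 <= B -> (#|P| <= N)%N -> (forall i, P i -> `|F i| <= B) ->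
  `|\sum_(i | P i) F i| <= N%:R * B.
Proof.
move=> B0 PN FB; apply: le_trans (ler_norm_sum _ _ _) _.
apply: le_trans (ler_sum _ FB) _.
by rewrite sumr_const -[B *+ _]mulr_natl ler_wpM2r// ler_nat.
Qed.

Lemma card_subsets (I : finType) (K : {set I}) :
  #|[pred Q : {set I} | Q \subset K]| = (2 ^ #|K|)%N.
Proof. by rewrite -card_powerset; apply: eq_card => Q; rewrite !inE. Qed.

(** * Threshold discrepancies and rainbow sets *)

Section Colourings.
Variables (R : numDomainType) (V : finType) (k l : nat) (h : {set V} -> R).

(** Hypergraphs are represented here by an arbitrary family [E] of sets, of
    which only the members of size [l] inside the sets under consideration
    count; this allows [E] to be filtered and complemented freely. *)
Definition edges_in (E : {set {set V}}) (T : {set V}) : {set {set V}} :=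
  [set e in E | (e \subset T) && (#|e| == l)].

Definition disc (s : nat) (W : {set V}) (E : {set {set V}}) : R :=
  \sum_(T : {set V} | (T \subset W) && (#|T| == k))
     h T * (s <= #|edges_in E T|)%N%:R.

Definition rainbow (c : V -> 'I_k) (T : {set V}) : bool := c @: T == setT.

Definition rainbow_disc (c : V -> 'I_k) (s : nat) (W : {set V})
    (E : {set {set V}}) : R :=
  \sum_(T : {set V} | (T \subset W) && (#|T| == k) && rainbow c T)
     h T * (s <= #|edges_in E T|)%N%:R.

Definition lsets : {set {set 'I_k}} := [set I : {set 'I_k} | #|I| == l].

Lemma card_lsets : #|lsets| = 'C(k, l).
Proof. by rewrite card_draws card_ord. Qed.

(** For a rainbow [T], the colour sets of the members of [edges_in E T]. The set
    [T :&: c @^-1: I] is the only subset of [T] with colour set [I]; defining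
    the palette through it makes the effect of filtering or complementing [E]
    immediate. *)
Definition palette (c : V -> 'I_k) (E : {set {set V}}) (T : {set V}) :
    {set {set 'I_k}} :=
  [set I in lsets | T :&: c @^-1: I \in E].

Lemma palette_sub (c : V -> 'I_k) (E : {set {set V}}) (T : {set V}) :
  palette c E T \subset lsets.
Proof. by apply/subsetP => I; rewrite inE => /andP[]. Qed.

Lemma rainbow_imsetK (c : V -> 'I_k) (T : {set V}) (I : {set 'I_k}) :
  rainbow c T -> c @: (T :&: c @^-1: I) = I.
Proof.
move=> /eqP cT; apply/setP => i; apply/imsetP/idP => [[v]|iI].
  by rewrite !inE => /andP[_ vI] ->.
have : i \in c @: T by rewrite cT inE.
by move=> /imsetP[v vT iv]; exists v => //; rewrite !inE vT -iv.
Qed.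

Lemma rainbow_inj (c : V -> 'I_k) (T : {set V}) :
  rainbow c T -> #|T| = k -> {in T &, injective c}.
Proof.
by move=> /eqP cT Tk; apply/imset_injP; rewrite cT cardsT card_ord Tk.
Qed.

Lemma card_palette (c : V -> 'I_k) (E : {set {set V}}) (T : {set V}) :
  rainbow c T -> #|T| = k ->
  #|palette c E T| = #|edges_in E T|.
Proof.
move=> rT Tk; have cinj := rainbow_inj rT Tk.
have liftK : cancel (fun I : {set 'I_k} => T :&: c @^-1: I) (fun e => c @: e).
  by move=> I; apply: rainbow_imsetK.
rewrite -(card_imset _ (can_inj liftK)); congr #|pred_of_set _|.
have card_lift (I : {set 'I_k}) : #|T :&: c @^-1: I| = #|I|.
  rewrite -{2}(rainbow_imsetK I rT) card_in_imset //.
  by move=> u v /setIP[uT _] /setIP[vT _]; apply: cinj.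
apply/setP => e; apply/imsetP/idP => [[I]|].
  rewrite !inE => /andP[Il IE] ->.
  by rewrite IE subsetIl card_lift.
rewrite inE => /and3P[eE eT el]; have liftc : T :&: c @^-1: (c @: e) = e.
  apply/setP => v; rewrite !inE; apply/andP/idP => [[vT /imsetP[u ue]]|ve].
    by move=> /cinj ->//; apply: (subsetP eT).
  by rewrite (subsetP eT) // imset_f.
by exists (c @: e); rewrite ?liftc // !inE -card_lift liftc el.
Qed.

(** Inclusion-exclusion: a colour that [T] misses can be toggled in [X]. *)
Lemma sum_signed_supersets_rainbow (c : V -> 'I_k) (T : {set V}) :
  \sum_(X : {set 'I_k}) (-1) ^+ #|X| * (c @: T \subset X)%:R
    = (-1) ^+ k * (rainbow c T)%:R :> R.
Proof.
rewrite /rainbow; case: eqP => [->|/eqP cT].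
  rewrite (bigD1 setT) //= subxx cardsT card_ord big1 ?addr0// => X XT.
  by rewrite subTset (negPf XT) mulr0.
have /subsetPn[i _ icT] : ~~ ([set: 'I_k] \subset c @: T).
  by rewrite subTset.
rewrite mulr0; under eq_bigl => X do rewrite -[true](subsetT X).
apply: (@sum_signed_subsets_eq0 _ _ _ i); rewrite ?inE // => X.
congr (_%:R); congr nat_of_bool; rewrite -subDset.
suff -> : c @: T :\: [set i] = c @: T by [].
by apply/setDidPl; rewrite disjoint_sym disjoints1.
Qed.

(** Restricting the vertex set [W] to the colours of [X] selects the sets [T]
    whose colours all lie in [X]; the signed sum over [X] keeps the rainbow ones
    and no others. *)
Lemma ler_norm_rainbow_disc (U : {set V}) (s : nat) (B : R) :
  (forall (W : {set V}) (E : {set {set V}}), W \subset U ->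
    `|disc s W E| <= B) ->
  forall c (W : {set V}) (E : {set {set V}}), W \subset U ->
    `|rainbow_disc c s W E| <= (2 ^ k)%:R * B.
Proof.
move=> HB c W E WU; have B0 : 0 <= B := le_trans (normr_ge0 _) (HB _ E WU).
have -> : rainbow_disc c s W E = (-1) ^+ k *
    \sum_(X : {set 'I_k}) (-1) ^+ #|X| * disc s (W :&: c @^-1: X) E.
  rewrite /rainbow_disc big_mkcondr /=.
  under [in RHS]eq_bigr => X _.
    rewrite /disc mulr_sumr big_mkcond /=.
    over.
  rewrite exchange_big mulr_sumr [LHS]big_mkcond /=; apply: eq_bigr => T _.
  case: (boolP (_ && _)) => [/andP[TW /eqP Tk]|nT]; last first.
    rewrite big1 ?mulr0// => X _; rewrite subsetI.
    by case: ifP => // /andP[/andP[TW _] Tk]; rewrite TW Tk in nT.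
  transitivity ((-1) ^+ k * \sum_(X : {set 'I_k})
      (-1) ^+ #|X| * (c @: T \subset X)%:R *
      (h T * (s <= #|edges_in E T|)%N%:R)).
    rewrite -mulr_suml sum_signed_supersets_rainbow !mulrA -exprD addnn.
    rewrite -mul2n exprM sqrrN !expr1n mul1r.
    by case: rainbow; rewrite ?mul1r ?mul0r.
  congr (_ * _); apply: eq_bigr => X _.
  rewrite subsetI TW Tk eqxx andbT /= sub_imset_pre.
  by case: (_ \subset _); rewrite ?mulr1 // mulr0 mul0r.
rewrite normrM normrX normrN1 expr1n mul1r.
apply: ler_norm_sum_const => //.
  by rewrite -cardsT -powersetT card_powerset cardsT card_ord.
move=> X _; rewrite normrM normrX normrN1 expr1n mul1r; apply: HB.
exact: subset_trans (subsetIl _ _) WU.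
Qed.

(** A signed sum over the families [Q] of colour sets, keeping in [E] only the
    edges with colour set in [Q], turns the indicator of threshold [s] into
    [kappa] times the indicator of cliques. Since [kappa] is a nonzero integer,
    no division is needed to get rid of it. *)
Lemma ler_norm_rainbow_clique (c : V -> 'I_k) (s : nat) (W : {set V}) (B : R) :
  (0 < s <= 'C(k, l))%N ->
  (forall E, `|rainbow_disc c s W E| <= B) ->
  forall E, `|rainbow_disc c 'C(k, l) W E| <= (2 ^ 'C(k, l))%:R * B.
Proof.
move=> /andP[s0 sm] HB E.
have B0 : 0 <= B := le_trans (normr_ge0 _) (HB E).
have m0 : (0 < #|lsets|)%N by rewrite card_lsets (leq_trans s0).
pose kappa : R := (-1) ^+ s * 'C('C(k, l).-1, s.-1)%:R.
have kappa1 : 1 <= `|kappa|.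
  rewrite normrM normrX normrN1 expr1n mul1r normr_nat ler1n bin_gt0.
  by rewrite -!subn1 leq_sub2r.
have key : kappa * rainbow_disc c 'C(k, l) W E =
    \sum_(Q : {set {set 'I_k}} | Q \subset lsets)
      (-1) ^+ #|Q| * rainbow_disc c s W [set e in E | c @: e \in Q].
  under [RHS]eq_bigr do rewrite /rainbow_disc mulr_sumr.
  rewrite exchange_big /rainbow_disc mulr_sumr /=.
  apply: eq_bigr => T /andP[/andP[_ /eqP Tk] rT].
  have := sum_signed_threshold_setI R s (palette_sub c E T).
  rewrite sum_signed_threshold // card_lsets -/kappa (card_palette E rT Tk).
  move=> keyT.
  rewrite mulrCA -keyT mulr_sumr; apply: eq_bigr => Q _; rewrite mulrCA.
  congr (_ * (_ * (_ <= _)%N%:R)); rewrite -(card_palette _ rT Tk).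
  congr #|pred_of_set _|; apply/setP => I.
  by rewrite !inE rainbow_imsetK // andbC andbA.
apply: (@le_trans _ _ (`|kappa * rainbow_disc c 'C(k, l) W E|)).
  by rewrite normrM ler_peMl.
rewrite key; apply: ler_norm_sum_const => //.
  by rewrite card_subsets card_lsets.
by move=> Q _; rewrite normrM normrX normrN1 expr1n mul1r; apply: HB.
Qed.

(** The rainbow sets above a threshold are classified by their palette [P], and
    complementing [E] among the [l]-sets with colour set outside [P] turns
    palette [P] into a clique. *)
Lemma ler_norm_rainbow_threshold (c : V -> 'I_k) (W : {set V}) (B : R) :
  (forall E, `|rainbow_disc c 'C(k, l) W E| <= B) ->
  forall s E, `|rainbow_disc c s W E| <= (2 ^ 'C(k, l))%:R * B.
Proof.
move=> HB s E; have B0 : 0 <= B := le_trans (normr_ge0 _) (HB E).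
have -> : rainbow_disc c s W E =
    \sum_(P : {set {set 'I_k}} | (P \subset lsets) && (s <= #|P|)%N)
      rainbow_disc c 'C(k, l) W [set e | (e \in E) == (c @: e \in P)].
  rewrite /rainbow_disc exchange_big /=.
  apply: eq_bigr => T /andP[/andP[_ /eqP Tk] rT].
  rewrite -mulr_sumr; congr (_ * _); rewrite -(card_palette E rT Tk).
  have cliqueE (P : {set {set 'I_k}}) : P \subset lsets ->
      ('C(k, l) <= #|edges_in [set e | (e \in E) == (c @: e \in P)] T|)%N =
      (P == palette c E T).
    move=> /subsetP Pl; rewrite -(card_palette _ rT Tk) -card_lsets.
    have := eqEcard (palette c [set e | (e \in E) == (c @: e \in P)] T) lsets.
    rewrite palette_sub /= => <-.
    apply/eqP/eqP => /setP eqJ; apply/setP => I; move: (eqJ I).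
      rewrite !inE rainbow_imsetK //.
      case: (boolP (#|I| == l)) => [_ /eqP|nI _] //=.
      by apply: contraNF nI => /Pl; rewrite inE.
    rewrite !inE rainbow_imsetK // => ->.
    by case: (#|I| == l) => //=; rewrite eqxx.
  rewrite big_mkcondr /= (bigD1 (palette c E T)) ?palette_sub //=.
  rewrite cliqueE ?palette_sub // eqxx big1 => [|P /andP[Pl PJ]].
    by rewrite addr0; case: leqP.
  by rewrite cliqueE // (negPf PJ); case: ifP.
apply: ler_norm_sum_const => //.
rewrite -card_lsets -card_subsets; apply: subset_leq_card.
by apply/subsetP => P; rewrite !inE => /andP[].
Qed.

(** A colouring making [T] rainbow is a bijection from [T] to the colours,
    together with arbitrary colours outside [T]. *)
Lemma card_rainbow (T : {set V}) : #|T| = k ->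
  #|[set c : {ffun V -> 'I_k} | rainbow c T]| = (k`! * k ^ (#|V| - k))%N.
Proof.
move=> Tk; pose e (i : 'I_k) : V := enum_val (cast_ord (esym Tk) i).
have eT i : e i \in T by apply: enum_valP.
have einj : injective e by move=> i j /enum_val_inj /cast_ord_inj.
have Te : e @: setT = T.
  apply/eqP; rewrite eqEcard card_imset // cardsT card_ord Tk leqnn andbT.
  by apply/subsetP => v /imsetP[i _ ->].
pose restr (c : {ffun V -> 'I_k}) : {ffun 'I_k -> 'I_k} := [ffun i => c (e i)].
have rainbowE (c : {ffun V -> 'I_k}) : rainbow c T = injectiveb (restr c).
  rewrite /rainbow -Te -imset_comp eqEcard subsetT /=.
  apply/idP/injectiveP => [cardT i j|cinj].
    rewrite !ffunE.
    have /imset_injP cinj : #|(c \o e) @: setT| == #|[set: 'I_k]|.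
      by rewrite eqn_leq leq_imset_card cardT.
    by apply: cinj; rewrite inE.
  rewrite card_imset // => i j ij.
  by apply: cinj; rewrite !ffunE.
(* Classify the colourings by their restriction to [T], read through [e]. *)
rewrite -sum1_card (partition_big restr (fun b => injectiveb b)); last first.
  by move=> c; rewrite inE rainbowE.
rewrite /= (eq_bigr (fun=> (k ^ (#|V| - k))%N)) => [|b binj].
  rewrite sum_nat_const; congr (_ * _)%N.
  have := card_inj_ffuns 'I_k 'I_k; rewrite card_ord ffactnn => <-.
  by rewrite cardsE; apply: eq_card.
(* [F v] is the set of values at [v] of the colourings that restrict to [b]. *)
pose F (v : V) : pred 'I_k :=
  if v \in T then [pred i | [exists j, (e j == v) && (b j == i)]] else predT.
transitivity #|family F|.
  rewrite -sum1_card; apply: eq_bigl => c; rewrite inE rainbowE.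
  apply/andP/familyP => [[_ /eqP cb] v|cF].
    rewrite /F; case: ifP => // vT; rewrite inE; move: vT.
    rewrite -Te => /imsetP[j _ ->]; apply/existsP; exists j.
    by rewrite eqxx -cb ffunE /=.
  have cb : restr c = b.
    apply/ffunP => i; rewrite ffunE; move: (cF (e i)); rewrite /F eT inE.
    by move=> /existsP[j /andP[/eqP /einj -> /eqP ->]].
  by rewrite cb.
rewrite card_family foldrE big_map big_enum /= (bigID (mem T)) /=.
rewrite big1 ?mul1n => [|v vT]; last first.
  rewrite /F vT; move: vT; rewrite -Te => /imsetP[j _ ->].
  rewrite -[RHS](card1 (b j)); apply: eq_card => i; rewrite !inE.
  apply/existsP/eqP => [[j' /andP[/eqP /einj -> /eqP->]]//|->].
  by exists j; rewrite !eqxx.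
rewrite (eq_bigr (fun=> k)) => [|v vT]; last by rewrite /F (negPf vT) card_ord.
by rewrite prod_nat_const -Tk -(cardC T) addKn.
Qed.

(** By [card_rainbow] each [k]-set is rainbow for equally many colourings, hence
    the sum of [rainbow_disc] over all colourings is a multiple of [disc]. *)
Lemma ler_norm_disc_average (W : {set V}) (E : {set {set V}}) (s : nat)
    (B : R) :
  (0 < k)%N -> (forall c, `|rainbow_disc c s W E| <= B) ->
  `|disc s W E| <= (k ^ k)%:R * B.
Proof.
move=> k0 HB.
have B0 : 0 <= B := le_trans (normr_ge0 _) (HB (fun=> Ordinal k0)).
have [Vk|Vk] := ltnP #|V| k.
  (* No [k]-sets exist, and the exponent [#|V| - k] below would be truncated. *)
  rewrite /disc big_pred0 ?normr0 ?mulr_ge0 // => T.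
  apply/negbTE; rewrite negb_and -orbC; apply/orP; left.
  by rewrite neq_ltn (leq_ltn_trans (max_card _) Vk).
have key : (k`! * k ^ (#|V| - k))%:R * disc s W E =
    \sum_(c : {ffun V -> 'I_k}) rainbow_disc c s W E.
  rewrite /rainbow_disc; under [RHS]eq_bigr do rewrite big_mkcondr.
  rewrite exchange_big mulr_sumr; apply: eq_bigr => T /andP[_ /eqP Tk] /=.
  by rewrite -big_mkcond sumr_const -(card_rainbow Tk) cardsE mulr_natl.
have kpos : 0 < (k ^ (#|V| - k))%:R :> R by rewrite ltr0n expn_gt0 k0.
rewrite -(ler_pM2l kpos) mulrA -natrM -expnD subnK //.
apply: (@le_trans _ _ `|(k`! * k ^ (#|V| - k))%:R * disc s W E|).
  by rewrite normrM normr_nat ler_wpM2r // ler_nat leq_pmull // fact_gt0.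
rewrite key; apply: ler_norm_sum_const => //.
by rewrite card_ffun card_ord.
Qed.

Lemma disc_threshold_change (U : {set V}) (s s' : nat) (B : R) :
  (0 < k)%N -> (0 < s <= 'C(k, l))%N ->
  (forall (W : {set V}) (E : {set {set V}}), W \subset U ->
    `|disc s W E| <= B) ->
  forall (W : {set V}) (E : {set {set V}}), W \subset U -> `|disc s' W E| <=
    (k ^ k)%:R * ((2 ^ 'C(k, l))%:R * ((2 ^ 'C(k, l))%:R * ((2 ^ k)%:R * B))).
Proof.
move=> k0 hs HB W E WU; apply: ler_norm_disc_average => // c.
apply: ler_norm_rainbow_threshold => {}E.
apply: ler_norm_rainbow_clique hs _ _ => {}E.
exact: ler_norm_rainbow_disc HB _ _ _ WU.
Qed.

End Colourings.

(** * From hypergraphs to threshold discrepancies *)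

Section Hypergraphs.
Variables (R : realType) (p : R) (V : finType) (k l : nat) (H : hypergraph V k).

Definition weight (T : {set V}) : R := (T \in eset H)%:R - p.

Lemma disc_weightE (s : nat) (G : hypergraph V l) :
  disc k l weight s (vset G) (eset G) =
  #|[set T in eset H |
     (T \subset vset G) && (s <= #|eset (Defs.induced G T)|)%N]|%:R
  - p * #|[set T : {set V} | [&& T \subset vset G, #|T| == k
                            & (s <= #|eset (Defs.induced G T)|)%N]]|%:R.
Proof.
have edgesE T : edges_in l (eset G) T = eset (Defs.induced G T).
  apply/setP => e; rewrite !inE; case: (boolP (e \in eset G)) => //= eG.
  by have [_ ->] := esetP eG; rewrite eqxx andbT.
rewrite -!sumr_const mulr_sumr /disc.
under eq_bigr do rewrite edgesE mulrBl.
rewrite big_split /= sumrN; congr (_ - _).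
  rewrite [LHS]big_mkcond [RHS]big_mkcond; apply: eq_bigr => T _ /=.
  rewrite !inE; case: (boolP (T \in eset H)) => [TH|_] /=; last first.
    by rewrite mul0r; case: ifP.
  have [_ ->] := esetP TH; rewrite eqxx andbT mul1r.
  by case: (T \subset _); case: leqP.
rewrite [LHS]big_mkcond [RHS]big_mkcond; apply: eq_bigr => T _ /=.
by rewrite !inE andbA; case: (_ && _) => //=; case: leqP; rewrite ?mulr0.
Qed.

Lemma edges_in_subproof (W : {set V}) (E : {set {set V}}) (e : {set V}) :
  e \in edges_in l E W -> e \subset W /\ #|e| = l.
Proof. by rewrite inE => /and3P[_ eW /eqP]. Qed.

Lemma disc_edges_in (s : nat) (W : {set V}) (E : {set {set V}})
    (h : {set V} -> R) :
  disc k l h s W E =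
  disc k l h s W (eset (Hypergraph (@edges_in_subproof W E))).
Proof.
apply: eq_bigr => T /andP[TW _]; congr (_ * (_ <= #|pred_of_set _|)%N%:R).
apply/setP => e; rewrite !inE; case: (e \in E) => //=.
case: (boolP (e \subset T)) => [eT|]; last by rewrite andbF.
by rewrite (subset_trans eT TW) /= andbb.
Qed.

End Hypergraphs.

(** The error function for [s'] is a constant multiple of the one for [s]. *)
Lemma CliqueDisc_threshold (R : realType) (k l s s' : nat) (p : R)
    (V : nat -> finType) (H : forall n : nat, hypergraph (V n) k) :
  (0 < k)%N -> (0 < s <= 'C(k, l))%N ->
  CliqueDisc p l s H -> CliqueDisc p l s' H.
Proof.
move=> k0 hs [f [f0 Hf]].
pose C : R :=
  (k ^ k)%:R * ((2 ^ 'C(k, l))%:R * ((2 ^ 'C(k, l))%:R * (2 ^ k)%:R)).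
exists (fun n => C * f n); split.
  rewrite -(mulr0 C); under eq_fun do rewrite -mulrA.
  exact: cvgMr.
move=> n G GH; rewrite -disc_weightE /C -!mulrA.
apply: (disc_threshold_change s' k0 hs _ _ GH) => W E WH.
rewrite disc_edges_in.
rewrite (disc_weightE p (H n) s (Hypergraph (@edges_in_subproof _ l W E))).
exact: Hf.
Qed.

Theorem theorem2 (R : realType) (k l : nat) (p : R)
    (hk : (3 <= k)%N) (hl : (2 <= l)%N) (hlk : (l < k)%N)
    (hp0 : 0 < p) (hp1 : p < 1)
    (s s' : nat) (hs : (1 <= s <= 'C(k, l))%N) (hs' : (1 <= s' <= 'C(k, l))%N)
    (V : nat -> finType) (H : forall n : nat, hypergraph (V n) k)
    (hH : forall n : nat, #|vset (H n)| = n) :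
  CliqueDisc p l s H <-> CliqueDisc p l s' H.
Proof.
have k0 : (0 < k)%N by apply: leq_trans hk.
by split; apply: CliqueDisc_threshold.
Qed.
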